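(* Let $E\subseteq\mathbb{R}^d$ be a bounded measurable set, let $K$ be a countable index set, let $\varphi$ be a (complex-valued) measurable function defined on $\mathbb{R}^d$, and let $\{\psi_k\}_{k\in K}$ be a Riesz basis of $L^2(E)$. Then $\{\varphi\psi_k\}_{k\in K}$ is a Riesz basis of $L^2(E)$ if and only if there exist constants $A,B$ with $0<A\le B<+\infty$ and $A\le|\varphi(t)|\le B$ for a.e. $t\in E$.
   Context: A sequence $\{\psi_k\}_{k\in K}$ in a separable Hilbert space $\mathcal{H}$ is a Riesz basis for $\mathcal{H}$ if it is complete in $\mathcal{H}$ (its span is dense) and there are constants $A,B>0$ such that for every finite scalar sequence $\{c_k\}$, $A\sum|c_k|^2\le\|\sum c_k\psi_k\|^2\le B\sum|c_k|^2$. Saying that $\{\varphi\psi_k\}$ is a Riesz basis of $L^2(E)$ includes $\varphi\psi_k\in L^2(E)$ for all $k$ (restricting $\varphi$ to $E$). *)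

(* Defs.v *)
From HB Require Import structures.
From mathcomp Require Import all_boot all_order all_algebra.
From mathcomp Require Import finmap.
From mathcomp Require Import all_classical all_reals all_analysis.
From mathcomp Require Import complex.

Set Implicit Arguments.
Unset Strict Implicit.
Unset Printing Implicit Defensive.

Import Order.TTheory GRing.Theory Num.Theory.
Import numFieldNormedType.Exports.
Import ComplexField.Normc.

Local Open Scope classical_set_scope.
Local Open Scope ring_scope.

(** * Lebesgue measure on R^d *)

(* The library only has the Lebesgue measure on R.  On R^d = 'rV[R]_d the
   Lebesgue measurable sets and the Lebesgue measure are obtained from the
   Lebesgue outer measure by Caratheodory's construction. *)

Section lebesgue_outer.
Context (R : realType) (d : nat).
Implicit Types (p : 'rV[R]_d * 'rV[R]_d) (X : set 'rV[R]_d).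

Definition box p : set 'rV[R]_d :=
  [set x | forall i, p.1 ord0 i <= x ord0 i <= p.2 ord0 i].

(* [box p] is empty as soon as one side has [p.2 ord0 i < p.1 ord0 i]; such a
   side counts for length 0. *)
Definition box_volume p : R :=
  \prod_(i < d) Num.max 0 (p.2 ord0 i - p.1 ord0 i).

Definition box_cover X (C : set ('rV[R]_d * 'rV[R]_d)) :=
  countable C /\ X `<=` \bigcup_(p in C) box p.

Definition lebesgue_outer X : \bar R :=
  ereal_inf [set (\esum_(p in C) (box_volume p)%:E)%E | C in box_cover X].

Lemma box_volume_ge0 p : (0 <= (box_volume p)%:E)%E.
Proof.
by rewrite lee_fin; apply: prodr_ge0 => i _; rewrite le_max lexx.
Qed.

Lemma lebesgue_outer_ge0 X : (0 <= lebesgue_outer X)%E.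
Proof.
apply: le_ereal_inf_tmp => _ [C _ <-].
by apply: esum_ge0 => p _; exact: box_volume_ge0.
Qed.

Lemma lebesgue_outer0 : lebesgue_outer set0 = 0%E.
Proof.
apply/eqP; rewrite eq_le lebesgue_outer_ge0 andbT.
apply: ereal_inf_lbound; exists set0; last by rewrite esum_set0.
by split; [exact: countable0 | exact: sub0set].
Qed.

Lemma le_lebesgue_outer : {homo lebesgue_outer : X Y / X `<=` Y >-> (X <= Y)%E}.
Proof.
move=> X Y XY; apply: ereal_inf_le_tmp => _ [C [cC YC] <-].
by exists C => //; split => //; exact: subset_trans YC.
Qed.

Lemma lebesgue_outer_sigma_subadditive : sigma_subadditive lebesgue_outer.
Proof.
move=> X; have [[i ioo]|] := pselect (exists i, lebesgue_outer (X i) = +oo%E).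
  rewrite (eseries_pinfty _ _ ioo) ?leey// => n _.
  by rewrite -ltNye (lt_le_trans _ (lebesgue_outer_ge0 _)).
rewrite -forallNE => Xoo.
apply/lee_addgt0Pr => e e0.
rewrite (le_trans _ (epsilon_trick _ _ (ltW e0)))//; last first.
  by move=> n; exact: lebesgue_outer_ge0.
have [C XC] : {C : (set ('rV[R]_d * 'rV[R]_d))^nat & forall n,
    box_cover (X n) (C n) /\
    (\esum_(p in C n) (box_volume p)%:E <=
      lebesgue_outer (X n) + (e / (2 ^ n.+1)%:R)%:E)%E}.
  apply: (@choice _ _ (fun n C => box_cover (X n) C /\
    (\esum_(p in C) (box_volume p)%:E <=
      lebesgue_outer (X n) + (e / (2 ^ n.+1)%:R)%:E)%E)) => n.
  have en : 0 < e / (2 ^ n.+1)%:R by rewrite divr_gt0// ltr0n expn_gt0.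
  have fX : lebesgue_outer (X n) \is a fin_num.
    by rewrite ge0_fin_numE ?lebesgue_outer_ge0// ltey; apply/eqP.
  have [_ [C XC <-] /ltW ?] := lb_ereal_inf_adherent en fX.
  by exists C.
apply: (@le_trans _ _
    (\esum_(p in \bigcup_n C n) (box_volume p)%:E)%E).
  apply: ereal_inf_lbound; exists (\bigcup_n C n) => //; split.
    by apply: bigcup_countable => // n _; exact: (XC n).1.1.
  move=> x [n _ /(XC n).1.2 [p Cp px]].
  by exists p => //; exists n.
rewrite seqDU_bigcup_eq.
rewrite (nneseries_sum_bigcup (@trivIset_seqDU _ C) box_volume_ge0).
apply: lee_nneseries => [n _ _|n _].
  by apply: esum_ge0 => p _; exact: box_volume_ge0.
apply: (le_trans _ (XC n).2).
apply: ge_ereal_sup => _ [F [fF FC] <-].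
apply: ereal_sup_ubound; exists F => //; split => //.
exact: subset_trans FC (@subset_seqDU _ C n).
Qed.

HB.instance Definition _ := isOuterMeasure.Build R 'rV[R]_d lebesgue_outer
  lebesgue_outer0 lebesgue_outer_ge0 le_lebesgue_outer
  lebesgue_outer_sigma_subadditive.

End lebesgue_outer.
Arguments lebesgue_outer : clear implicits.

(* R^d with its sigma-algebra of Lebesgue measurable sets; as a bare type it is
   'rV[R]_d. *)
Notation Rn R d := (caratheodory_type (lebesgue_outer R d)).

Definition lebesgue_rV (R : realType) (d : nat) :
    {measure set (Rn R d) -> \bar R} :=
  (lebesgue_outer R d : {outer_measure set 'rV[R]_d -> \bar R}).
Arguments lebesgue_rV : clear implicits.

(** * Complex-valued functions and L^2(E) *)

Section L2.
Context (d : measure_display) (T : measurableType d) (R : realType).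
Variables (mu : {measure set T -> \bar R}) (E : set T).

Definition cmeasurable_fun (D : set T) (f : T -> R[i]) :=
  measurable_fun D (fun t => complex.Re (f t)) /\
  measurable_fun D (fun t => complex.Im (f t)).

(* Elements of L^2(E) are given by representatives: functions on the whole of
   [T] of which only the values on E matter.  [L2norm] is then a seminorm which
   identifies a.e. equal functions. *)
Definition L2 : set (T -> R[i]^o) :=
  [set f | cmeasurable_fun E f /\
           (\int[mu]_(t in E) (normc (f t) ^+ 2)%:E < +oo)%E].

Definition L2norm (f : T -> R[i]^o) : R :=
  Num.sqrt (\int[mu]_(t in E) (normc (f t) ^+ 2)).

End L2.

(** * Riesz bases *)

(* The Hilbert space is presented by a subspace [H] of [V] and a seminorm [N] on
   it, two vectors at distance 0 being identified. *)
Section riesz_basis.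
Context (R : realType) (V : lmodType R[i]) (H : set V) (N : V -> R).
Context (K : countType).
Implicit Types (psi : K -> V).

Definition complete_seq psi :=
  forall f, H f -> forall e : R, 0 < e ->
  exists (D : {fset K}) (c : K -> R[i]),
    N (f - \sum_(k <- D) c k *: psi k) < e.

Definition riesz_basis psi :=
  [/\ forall k, H (psi k),
      complete_seq psi &
      exists A B : R, [/\ 0 < A, 0 < B &
        forall (D : {fset K}) (c : K -> R[i]),
          A * \sum_(k <- D) normc (c k) ^+ 2
            <= N (\sum_(k <- D) c k *: psi k) ^+ 2
            <= B * \sum_(k <- D) normc (c k) ^+ 2]].

End riesz_basis.

(* Main.v *)
(** Multiplication by [phi] sends [sum c_k psi_k] to [sum c_k phi psi_k], so the
    two Riesz bounds make it bounded above and below on the span of the [psi_k].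
    By density the upper bound passes to every [f] in L^2(E), first for the
    integral of [|phi f|^2] over a set on which [phi] is bounded.  Testing it on
    the indicator of [{m < |phi| <= n}], which is in L^2(E) because [E] has finite
    measure, shows that this set is null when [m] is large; hence [phi] is
    essentially bounded, the lower bound passes to L^2(E) as well, and it is
    tested on the indicator of [{|phi| < a}].
    Conversely, [f] is approximated by [phi] times an approximation of [f / phi].

    Using [|x + y|^2 <= 2 |x|^2 + 2 |y|^2] in place of Minkowski's inequality
    costs a factor 4 in the constants. *)

Require Import Defs.
From mathcomp Require Import all_boot all_order all_algebra.
From mathcomp Require Import finmap.
From mathcomp Require Import all_classical all_reals all_analysis.
From mathcomp Require Import complex measurable_realfun.
From mathcomp Require Import lra.
Set Implicit Arguments.
Unset Strict Implicit.
Unset Printing Implicit Defensive.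

Import Order.TTheory GRing.Theory Num.Theory.
Import numFieldNormedType.Exports.
Import ComplexField.Normc.
Local Open Scope classical_set_scope.
Local Open Scope ring_scope.

(** * Squared moduli and measurability of complex-valued functions *)

Section complex_measurable.
Context {d : measure_display} {T : measurableType d} {R : realType}.
Implicit Types (D : set T) (f g : T -> R[i]).

Lemma sqr_normc (z : R[i]) : normc z ^+ 2 = complex.Re z ^+ 2 + complex.Im z ^+ 2.
Proof. by case: z => a b /=; rewrite sqr_sqrtr// addr_ge0// sqr_ge0. Qed.

Lemma normc_ge0 (z : R[i]) : 0 <= normc z.
Proof. by case: z => a b; exact: sqrtr_ge0. Qed.

Lemma sqr_normcD (x y : R[i]) :
  normc (x + y) ^+ 2 <= 2 * normc x ^+ 2 + 2 * normc y ^+ 2.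
Proof.
rewrite !sqr_normc !raddfD/=.
(* By the parallelogram law the two sides differ by [|x - y|^2], the sum of these two squares. *)
have := sqr_ge0 (complex.Re x - complex.Re y).
have := sqr_ge0 (complex.Im x - complex.Im y).
by nra.
Qed.

Lemma sqr_normcB (x y : R[i]) :
  normc x ^+ 2 <= 2 * normc y ^+ 2 + 2 * normc (x - y) ^+ 2.
Proof. by rewrite -{1}(subrKC y x); exact: sqr_normcD. Qed.

Lemma cmeasurable_funS D E f : measurable E -> D `<=` E ->
  cmeasurable_fun E f -> cmeasurable_fun D f.
Proof. by move=> mE DE [? ?]; split; exact: (measurable_funS mE DE). Qed.

Lemma cmeasurable_fun_cst D (z : R[i]) : cmeasurable_fun D (cst z).
Proof. by split; exact: measurable_cst. Qed.

Lemma cmeasurable_funD D f g : cmeasurable_fun D f -> cmeasurable_fun D g ->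
  cmeasurable_fun D (fun t => f t + g t).
Proof.
move=> [f1 f2] [g1 g2]; split.
- apply: (eq_measurable_fun _ _ (measurable_funD f1 g1)) => t _.
  by rewrite /= raddfD.
- apply: (eq_measurable_fun _ _ (measurable_funD f2 g2)) => t _.
  by rewrite /= raddfD.
Qed.

Lemma cmeasurable_funM D f g : cmeasurable_fun D f -> cmeasurable_fun D g ->
  cmeasurable_fun D (fun t => f t * g t).
Proof.
move=> [f1 f2] [g1 g2]; split.
- apply: (eq_measurable_fun _ _
    (measurable_funB (measurable_funM f1 g1) (measurable_funM f2 g2))) => t _ /=.
  by case: (f t) (g t) => [a b] [a' b'].
- apply: (eq_measurable_fun _ _
    (measurable_funD (measurable_funM f1 g2) (measurable_funM f2 g1))) => t _ /=.
  by case: (f t) (g t) => [a b] [a' b'].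
Qed.

Lemma cmeasurable_funB D f g : cmeasurable_fun D f -> cmeasurable_fun D g ->
  cmeasurable_fun D (fun t => f t - g t).
Proof.
move=> mf mg.
have -> : (fun t => f t - g t) = (fun t => f t + cst (-1) t * g t).
  by apply/funext => t; rewrite mulN1r.
exact: cmeasurable_funD mf (cmeasurable_funM (cmeasurable_fun_cst _ _) mg).
Qed.

Lemma measurable_sqr_normc D f : cmeasurable_fun D f ->
  measurable_fun D (fun t => normc (f t) ^+ 2).
Proof.
move=> [f1 f2]; apply: (eq_measurable_fun _ _
  (measurable_funD (measurable_funX 2 f1) (measurable_funX 2 f2))) => t _.
by rewrite /= sqr_normc.
Qed.

(** The inverse is the conjugate divided by the squared modulus. Zeros of [f] need no separate case,
    since both the inverse and the power [-1] are 0 at 0. *)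
Lemma cmeasurable_funV D f : cmeasurable_fun D f ->
  cmeasurable_fun D (fun t => (f t)^-1).
Proof.
move=> mf; have mV : measurable_fun D (fun t => (normc (f t) ^+ 2)^-1).
  apply: (eq_measurable_fun (fun t => (normc (f t) ^+ 2) `^ (-1))) => [t _|].
    by rewrite /= powR_inv1// sqr_ge0.
  exact: (measurableT_comp (measurable_powR (-1)) (measurable_sqr_normc mf)).
case: mf => f1 f2; split.
- apply: (eq_measurable_fun _ _ (measurable_funM f1 mV)) => t _.
  by rewrite /= sqr_normc; case: (f t).
- apply: (eq_measurable_fun _ _ (measurable_funN (measurable_funM f2 mV))) => t _.
  by rewrite /= sqr_normc; case: (f t).
Qed.

Lemma cmeasurable_fun_indic D A : measurable A ->
  cmeasurable_fun D (fun t => (\1_A t : R)%:C%C).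
Proof. by move=> mA; split; [exact: measurable_indic|exact: measurable_cst]. Qed.

End complex_measurable.

(** * The squared L^2 seminorm and the closure properties of L^2(E) *)

Section L2_theory.
Context {d : measure_display} {T : measurableType d} {R : realType}.
Variable mu : {measure set T -> \bar R}.
Implicit Types (D E S : set T) (f g : T -> R[i]).

(** Extended real values allow estimates on [phi * f] before it is known to lie in L^2(E);
    [sqr_L2norm] returns to the real seminorm. *)
Definition L2sq E f : \bar R := (\int[mu]_(t in E) (normc (f t) ^+ 2)%:E)%E.

Lemma L2sq_ge0 E f : (0 <= L2sq E f)%E.
Proof. by apply: integral_ge0 => t _; rewrite lee_fin sqr_ge0. Qed.

Lemma measurable_L2sq E f : cmeasurable_fun E f ->
  measurable_fun E (fun t => (normc (f t) ^+ 2)%:E).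
Proof. by move=> mf; apply/measurable_EFinP; exact: measurable_sqr_normc. Qed.

Lemma L2sqZ E (k : R) f : measurable E -> 0 <= k -> cmeasurable_fun E f ->
  (\int[mu]_(t in E) (k * normc (f t) ^+ 2)%:E = k%:E * L2sq E f)%E.
Proof.
move=> mE k0 mf; rewrite /L2sq -ge0_integralZl//.
- exact: measurable_L2sq.
- by move=> t _; rewrite lee_fin sqr_ge0.
Qed.

Lemma measurable_L2sqZ E (k : R) f : cmeasurable_fun E f ->
  measurable_fun E (fun t => (k * normc (f t) ^+ 2)%:E).
Proof.
move=> mf; apply/measurable_EFinP.
exact: measurable_funM (measurable_cst _) (measurable_sqr_normc mf).
Qed.

(** The pointwise hypothesis lets one statement serve both sums ([L2D]) and differences
    ([L2sqB]). *)
Lemma L2sqD E f g h : measurable E -> cmeasurable_fun E f ->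
  cmeasurable_fun E g -> cmeasurable_fun E h ->
  (forall t, E t -> normc (f t) ^+ 2 <= 2 * normc (g t) ^+ 2 + 2 * normc (h t) ^+ 2) ->
  (L2sq E f <= 2%:E * L2sq E g + 2%:E * L2sq E h)%E.
Proof.
move=> mE mf mg mh fgh.
rewrite -!L2sqZ// -ge0_integralD//; first last.
- exact: measurable_L2sqZ.
- by move=> t _; rewrite lee_fin mulr_ge0// sqr_ge0.
- exact: measurable_L2sqZ.
- by move=> t _; rewrite lee_fin mulr_ge0// sqr_ge0.
apply: ge0_le_integral => //.
- by move=> t _; rewrite lee_fin sqr_ge0.
- exact: measurable_L2sq.
- by apply: emeasurable_funD; exact: measurable_L2sqZ.
Qed.

Lemma L2sqB E f g : measurable E -> cmeasurable_fun E f -> cmeasurable_fun E g ->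
  (L2sq E f <= 2%:E * L2sq E g + 2%:E * L2sq E (fun t => f t - g t)%R)%E.
Proof.
move=> mE mf mg; apply: L2sqD => //; first exact: cmeasurable_funB.
by move=> t _; exact: sqr_normcB.
Qed.

Lemma L2sqC E f g : L2sq E (fun t => f t - g t) = L2sq E (fun t => g t - f t).
Proof. by apply: eq_integral => t _; rewrite -(normcN (f t - g t)) opprB. Qed.

Lemma L2sqS D E f : measurable D -> measurable E -> D `<=` E ->
  cmeasurable_fun E f -> (L2sq D f <= L2sq E f)%E.
Proof.
move=> mD mE DE mf; apply: ge0_subset_integral => //.
- exact: measurable_L2sq.
- by move=> t _; rewrite lee_fin sqr_ge0.
Qed.

Lemma ae_L2sq_le E (k : R) f g : measurable E -> 0 <= k ->
  cmeasurable_fun E f -> cmeasurable_fun E g ->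
  {ae mu, forall t, E t -> normc (f t) ^+ 2 <= k * normc (g t) ^+ 2} ->
  (L2sq E f <= k%:E * L2sq E g)%E.
Proof.
move=> mE k0 mf mg fg; rewrite -L2sqZ//; apply: ae_ge0_le_integral => //.
- by move=> t _; rewrite lee_fin sqr_ge0.
- exact: measurable_L2sq.
- by move=> t _; rewrite lee_fin mulr_ge0// sqr_ge0.
- exact: measurable_L2sqZ.
Qed.

Lemma ae_L2sqM_le E (B : R) f phi : measurable E ->
  cmeasurable_fun E f -> cmeasurable_fun E phi ->
  {ae mu, forall t, E t -> normc (phi t) <= B} ->
  (L2sq E (fun t => phi t * f t)%R <= (B ^+ 2)%:E * L2sq E f)%E.
Proof.
move=> mE mf mphi phiB; apply: ae_L2sq_le => //; first exact: sqr_ge0.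
  exact: cmeasurable_funM.
apply: filterS phiB => t phiB Et.
rewrite normcM exprMn ler_wpM2r ?sqr_ge0// lerXn2r ?nnegrE ?normc_ge0 ?phiB//.
exact: le_trans (normc_ge0 _) (phiB Et).
Qed.

Lemma ae_L2sqM_ge E (A : R) f phi : measurable E -> 0 < A ->
  cmeasurable_fun E f -> cmeasurable_fun E phi ->
  {ae mu, forall t, E t -> A <= normc (phi t)} ->
  (L2sq E f <= (A ^- 2)%:E * L2sq E (fun t => phi t * f t)%R)%E.
Proof.
move=> mE A0 mf mphi phiA; apply: ae_L2sq_le => //.
- by rewrite invr_ge0 sqr_ge0.
- exact: cmeasurable_funM.
apply: filterS phiA => t phiA Et.
rewrite mulrC ler_pdivlMr ?exprn_gt0// mulrC normcM exprMn.
by rewrite ler_wpM2r ?sqr_ge0// lerXn2r ?nnegrE ?normc_ge0 ?phiA// ltW.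
Qed.

Lemma L2sq_indic E S : measurable E -> measurable S ->
  L2sq E (fun t => (\1_S t : R)%:C%C) = mu (S `&` E).
Proof.
move=> mE mS; rewrite -integral_indic//; apply: eq_integral => t _.
by rewrite sqr_normc/= expr0n addr0 indicE; case: (_ \in _); rewrite ?expr1n ?expr0n.
Qed.

Lemma L2_fin_num E f : L2 mu E f -> L2sq E f \is a fin_num.
Proof. by move=> [_ foo]; rewrite ge0_fin_numE// L2sq_ge0. Qed.

Lemma sqr_L2norm E f : L2 mu E f -> (L2norm mu E f ^+ 2)%:E = L2sq E f.
Proof.
move=> fL2; rewrite /L2norm /Rintegral sqr_sqrtr ?fine_ge0 ?L2sq_ge0//.
by rewrite fineK// L2_fin_num.
Qed.

Lemma L2D E (f g : T -> R[i]^o) : measurable E ->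
  L2 mu E f -> L2 mu E g -> L2 mu E (f + g).
Proof.
move=> mE [mf foo] [mg goo]; have mfg := cmeasurable_funD mf mg.
split; first exact: mfg.
apply: le_lt_trans (L2sqD mE mfg mf mg (fun t _ => sqr_normcD _ _)) _.
by rewrite lte_add_pinfty// lte_mul_pinfty.
Qed.

Lemma L2_mul E (B : R) f g : measurable E -> L2 mu E f -> cmeasurable_fun E g ->
  {ae mu, forall t, E t -> normc (g t) <= B} -> L2 mu E (fun t => g t * f t).
Proof.
move=> mE [mf foo] mg gB; split; first exact: cmeasurable_funM.
apply: le_lt_trans (ae_L2sqM_le mE mf mg gB) _.
by rewrite lte_mul_pinfty// lee_fin sqr_ge0.
Qed.

Lemma L2Z E (c : R[i]) (f : T -> R[i]^o) : measurable E -> L2 mu E f ->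
  L2 mu E (c *: f).
Proof.
move=> mE fL2; apply: (L2_mul (B := normc c) (g := cst c)) => //.
exact: aeW.
Qed.

Lemma L20 E : L2 mu E 0.
Proof.
split; first exact: cmeasurable_fun_cst.
by rewrite integral0_eq// => t _; rewrite normc0 expr0n.
Qed.

Lemma L2_sum E (K : eqType) (s : seq K) (c : K -> R[i]) (psi : K -> T -> R[i]^o) :
  measurable E -> (forall k, L2 mu E (psi k)) ->
  L2 mu E (\sum_(k <- s) c k *: psi k).
Proof.
move=> mE psiL2; apply: (big_ind (L2 mu E)) => [|f g|k _].
- exact: L20.
- exact: L2D.
- exact: L2Z.
Qed.

Lemma L2_indic E S : measurable E -> (mu E < +oo)%E -> measurable S ->
  L2 mu E (fun t => (\1_S t : R)%:C%C).
Proof.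
move=> mE Eoo mS; split; first exact: cmeasurable_fun_indic.
rewrite [ltLHS]L2sq_indic//; apply: le_lt_trans Eoo.
by apply: le_measure; rewrite ?inE//; exact: measurableI.
Qed.

(** Turns the Riesz bounds of the products [phi psi_k] into bounds on [phi * g] for [g] in the span
    of the [psi_k]. *)
Lemma sum_mul_fct (K : eqType) (s : seq K) (c : K -> R[i])
    (phi : T -> R[i]) (psi : K -> T -> R[i]^o) :
  \sum_(k <- s) c k *: (fun t => phi t * psi k t : R[i]^o) =
  (fun t => phi t * (\sum_(k <- s) c k *: psi k) t).
Proof.
apply/funext => t; rewrite !fct_sumE mulr_sumr.
by apply: eq_bigr => k _; exact: mulrCA.
Qed.

End L2_theory.

(** * Extending multiplier bounds from a dense set [W] to [f] *)

Section dense_multiplier.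
Context {d : measure_display} {T : measurableType d} {R : realType}.
Variables (mu : {measure set T -> \bar R}) (E : set T) (W : set (T -> R[i])).
Hypotheses (mE : measurable E) (mW : forall g, W g -> cmeasurable_fun E g).
Variables (phi f : T -> R[i]) (C : R).
Hypotheses (mphi : cmeasurable_fun E phi) (mf : cmeasurable_fun E f).
Hypotheses (f_fin : L2sq mu E f \is a fin_num)
  (Wf : forall e : R, 0 < e ->
    exists2 g, W g & (L2sq mu E (fun t => f t - g t)%R <= e%:E)%E).

(* [S] and [M] are needed because multiplication by [phi] is not yet known to be
   continuous on L^2(E); the resulting bound does not depend on them. *)
Lemma L2sqM_dense_le (S : set T) (M : R) : 0 <= C -> measurable S -> S `<=` E ->
  (forall t, S t -> normc (phi t) <= M) ->
  (forall g, W g ->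
    (L2sq mu E (fun t => phi t * g t)%R <= C%:E * L2sq mu E g)%E) ->
  (L2sq mu S (fun t => phi t * f t)%R <= (4 * C)%:E * L2sq mu E f)%E.
Proof.
move=> C0 mS SE phiM phiW; apply/lee_addgt0Pr => e e0.
(* With [f] approximated within [e / k], the errors below add up to
   [(2 * M ^+ 2 + 4 * C) * (e / k)], hence to at most [e]; the 1 keeps [k] positive. *)
pose k : R := 2 * M ^+ 2 + 4 * C + 1.
have M20 : 0 <= M ^+ 2 by exact: sqr_ge0.
have k0 : 0 < k by rewrite /k; lra.
have [g Wg fg] := Wf (divr_gt0 e0 k0).
have mg := mW Wg.
have h1 := L2sqB mu mS (cmeasurable_funS mE SE (cmeasurable_funM mphi mf))
  (cmeasurable_funS mE SE (cmeasurable_funM mphi mg)).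
apply: (le_trans h1).
have h2 : (L2sq mu S (fun t => phi t * g t)%R <=
    C%:E * (2%:E * L2sq mu E f + 2%:E * (e / k)%:E))%E.
  apply: le_trans (L2sqS mu mS mE SE (cmeasurable_funM mphi mg)) _.
  apply: le_trans (phiW _ Wg) _.
  rewrite lee_wpmul2l// ?lee_fin//.
  apply: le_trans (L2sqB mu mE mg mf) _.
  by rewrite leeD2l// lee_wpmul2l// ?lee_fin// L2sqC.
(* The bound [M] on [S] enters only here, multiplied by the error [e / k], so it disappears from the
   final constant. *)
have h3 : (L2sq mu S (fun t => phi t * f t - phi t * g t)%R <=
    (M ^+ 2)%:E * (e / k)%:E)%E.
  under [X in L2sq _ _ X]eq_fun do rewrite -mulrBr.
  have mfg := cmeasurable_funB mf mg.
  apply: le_trans (ae_L2sqM_le mS (cmeasurable_funS mE SE mfg)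
    (cmeasurable_funS mE SE mphi) (aeW _ phiM)) _.
  rewrite lee_wpmul2l// ?lee_fin//.
  exact: le_trans (L2sqS mu mS mE SE mfg) fg.
apply: (@le_trans _ _ (2%:E * (C%:E * (2%:E * L2sq mu E f + 2%:E * (e / k)%:E))
   + 2%:E * ((M ^+ 2)%:E * (e / k)%:E))%E).
  by apply: leeD; rewrite lee_wpmul2l// lee_fin.
rewrite -(fineK f_fin) -!EFinM -!EFinD lee_fin.
have : 0 <= e / k by rewrite divr_ge0// ltW.
have : e / k * k = e by rewrite divfK// gt_eqF.
by move: (e / k) => u <-; rewrite /k; nra.
Qed.

(** The essential bound [B] makes multiplication by [phi] continuous, so [phi * g] is close to
    [phi * f] whenever [g] is close to [f]. The bound for [g] is then transferred to [f]. *)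
Lemma L2sqM_dense_ge (B : R) : 0 <= C ->
  {ae mu, forall t, E t -> normc (phi t) <= B} ->
  (forall g, W g ->
    (L2sq mu E g <= C%:E * L2sq mu E (fun t => phi t * g t)%R)%E) ->
  (L2sq mu E f <= (4 * C)%:E * L2sq mu E (fun t => phi t * f t)%R)%E.
Proof.
move=> C0 phiB phiW; apply/lee_addgt0Pr => e e0.
(* The errors add up to [(4 * C * B ^+ 2 + 2) * (e / k)], which is at most [e]. *)
pose k : R := 4 * C * B ^+ 2 + 3.
have B20 : 0 <= B ^+ 2 by exact: sqr_ge0.
have k0 : 0 < k by rewrite /k; nra.
have [g Wg fg] := Wf (divr_gt0 e0 k0).
have mg := mW Wg.
have mfg := cmeasurable_funB mf mg.
have h0 : (L2sq mu E (fun t => phi t * g t)%R <= 2%:E * L2sq mu E (fun t => phi t * f t)%R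
   + 2%:E * ((B ^+ 2)%:E * (e / k)%:E))%E.
  apply: le_trans (L2sqB mu mE (cmeasurable_funM mphi mg) (cmeasurable_funM mphi mf)) _.
  rewrite leeD2l// lee_wpmul2l// ?lee_fin// L2sqC.
  under [X in L2sq _ _ X]eq_fun do rewrite -mulrBr.
  apply: le_trans (ae_L2sqM_le mE mfg mphi phiB) _.
  by rewrite lee_wpmul2l// ?lee_fin.
have h1 : (L2sq mu E g <= C%:E * (2%:E * L2sq mu E (fun t => phi t * f t)%R
   + 2%:E * ((B ^+ 2)%:E * (e / k)%:E)))%E.
  by apply: le_trans (phiW _ Wg) _; rewrite lee_wpmul2l// ?lee_fin.
apply: le_trans (L2sqB mu mE mf mg) _.
apply: (@le_trans _ _ (2%:E * (C%:E * (2%:E * L2sq mu E (fun t => phi t * f t)%R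
   + 2%:E * ((B ^+ 2)%:E * (e / k)%:E))) + 2%:E * (e / k)%:E)%E).
  by apply: leeD; rewrite lee_wpmul2l// lee_fin.
have pf_fin : L2sq mu E (fun t => phi t * f t) \is a fin_num.
  rewrite ge0_fin_numE ?L2sq_ge0//.
  apply: le_lt_trans (ae_L2sqM_le mE mf mphi phiB) _.
  by rewrite -(fineK f_fin) -EFinM ltry.
rewrite -(fineK pf_fin) -!EFinM -!EFinD lee_fin.
have : 0 <= e / k by rewrite divr_ge0// ltW.
have : e / k * k = e by rewrite divfK// gt_eqF.
by move: (e / k) => u <-; rewrite /k; nra.
Qed.

End dense_multiplier.

(** * From integral bounds to essential bounds on [|phi|] *)

Lemma ereal_eq0_contraction (R : realType) (x : \bar R) (k : R) :
  (0 <= x)%E -> (x < +oo)%E -> k < 1 -> (x <= k%:E * x)%E -> x = 0%E.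
Proof.
case: x => [x||]//; rewrite -EFinM !lee_fin => x0 _ k1 xkx.
by congr EFin; nra.
Qed.

Section essential_bounds.
Context {d : measure_display} {T : measurableType d} {R : realType}.
Variables (mu : {measure set T -> \bar R}) (E : set T) (phi : T -> R[i]).

(** Comparing squares reduces the claim to the squared modulus, a polynomial in the real and
    imaginary parts. *)
Lemma measurable_gt_normc (a : R) : measurable E -> cmeasurable_fun E phi ->
  0 <= a -> measurable (E `&` [set t | a < normc (phi t)]).
Proof.
move=> mE mphi a0.
have := measurable_fun_ltr (measurable_cst (a ^+ 2)) (measurable_sqr_normc mphi).
move=> /(_ mE [set true] I); congr measurable; apply/seteqP.
by split=> t /= [Et]; rewrite ltr_pXn2r// ?nnegrE ?normc_ge0//.
Qed.

Lemma measurable_lt_normc (a : R) : measurable E -> cmeasurable_fun E phi ->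
  0 <= a -> measurable (E `&` [set t | normc (phi t) < a]).
Proof.
move=> mE mphi a0.
have := measurable_fun_ltr (measurable_sqr_normc mphi) (measurable_cst (a ^+ 2)).
move=> /(_ mE [set true] I); congr measurable; apply/seteqP.
by split=> t /= [Et]; rewrite ltr_pXn2r// ?nnegrE ?normc_ge0//.
Qed.

Hypotheses (mE : measurable E) (Eoo : (mu E < +oo)%E) (mphi : cmeasurable_fun E phi).
Variable W : set (T -> R[i]).
Hypotheses (WL2 : forall g, W g -> L2 mu E g)
  (denseW : forall f, L2 mu E f -> forall e : R, 0 < e ->
    exists2 g, W g & (L2sq mu E (fun t => f t - g t)%R <= e%:E)%E).

Lemma multiplier_ae_le (C : R) : 0 <= C ->
  (forall g, W g ->
    (L2sq mu E (fun t => phi t * g t)%R <= C%:E * L2sq mu E g)%E) ->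
  {ae mu, forall t, E t -> normc (phi t) <= 4 * C + 1}.
Proof.
move=> C0 phiW; pose m : R := 4 * C + 1.
have m0 : 0 < m by rewrite /m; lra.
(* This is the part of [E] where [m < |phi| <= n]; the cap [n] supplies the bound required by
   [L2sqM_dense_le]. *)
pose S n := (E `&` [set t | m < normc (phi t)]) `\`
            (E `&` [set t | n%:R < normc (phi t)]).
have mS n : measurable (S n).
  by apply: measurableD; apply: measurable_gt_normc => //; exact: ltW.
have SE n : S n `<=` E by move=> t [[]].
have S0 n : mu (S n) = 0%E.
  have Soo : (mu (S n) < +oo)%E.
    by apply: le_lt_trans Eoo; apply: le_measure; rewrite ?inE.
  (* On [S n], [m ^+ 2 * mu (S n)] is at most the integral of [|phi|^2], hence at most
     [4 * C * mu (S n)]. The choice [m = 4 * C + 1] gives [4 * C < m ^+ 2], and finiteness of the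
     measure forces it to vanish. *)
  apply: (@ereal_eq0_contraction _ _ (m ^- 2 * (4 * C))) => //.
    rewrite mulrC ltr_pdivrMr ?exprn_gt0// mul1r /m.
    by nra.
  have m1S := cmeasurable_fun_indic (R := R) (S n) (mS n).
  have SL2 : L2 mu E (fun t => (\1_(S n) t : R)%:C%C) by exact: L2_indic.
  have := @ae_L2sqM_ge _ _ _ mu (S n) m _ phi (mS n) m0 m1S
    (cmeasurable_funS mE (SE n) mphi).
  rewrite L2sq_indic// setIid => h.
  apply: le_trans (h _) _; first by apply: aeW => t [[_ /ltW]].
  rewrite EFinM -muleA lee_wpmul2l// ?lee_fin ?invr_ge0 ?sqr_ge0//.
  have := @L2sqM_dense_le _ _ _ mu E W mE (fun g Wg => (WL2 Wg).1) phi _ C mphi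
    SL2.1 (L2_fin_num SL2) (denseW SL2) (S n) n%:R C0 (mS n) (@SE n) _ phiW.
  rewrite L2sq_indic// setIidl//; apply => t [[Et _] /= nt].
  by rewrite leNgt; apply/negP => tn; apply: nt.
suff : mu.-negligible (\bigcup_n S n).
  apply: negligibleS => t /= /not_implyP[Et /negP]; rewrite -ltNge => mt.
  (* The successor of the integer part exceeds [|phi t|], so every point with [|phi t| > m] lies in
     some [S n]. *)
  exists (Num.truncn (normc (phi t))).+1 => //; split => // -[_ /=].
  by rewrite ltNge ltW// truncnS_gt.
by apply: negligible_bigcup => n; apply/(negligibleP _ (mS n)); exact: S0.
Qed.

Lemma multiplier_ae_ge (B C : R) : 0 <= C ->
  {ae mu, forall t, E t -> normc (phi t) <= B} ->
  (forall g, W g ->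
    (L2sq mu E g <= C%:E * L2sq mu E (fun t => phi t * g t)%R)%E) ->
  {ae mu, forall t, E t -> (4 * C + 1)^-1 <= normc (phi t)}.
Proof.
move=> C0 phiB phiW; pose a : R := (4 * C + 1)^-1.
have a0 : 0 < a by rewrite invr_gt0; lra.
have aC : a * (4 * C + 1) = 1 by rewrite mulVf// gt_eqF//; lra.
pose S := E `&` [set t | normc (phi t) < a].
have mS : measurable S by apply: measurable_lt_normc => //; exact: ltW.
have SE : S `<=` E by move=> t [].
have SL2 : L2 mu E (fun t => (\1_S t : R)%:C%C) by exact: L2_indic.
have S0 : mu S = 0%E.
  have Soo : (mu S < +oo)%E.
    by apply: le_lt_trans Eoo; apply: le_measure; rewrite ?inE.
  (* The indicator of [S] has squared norm [mu S], while [phi] times it has squared norm at most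
     [a ^+ 2 * mu S]. Since [4 * C * a = 1 - a], the ratio is [a * (1 - a) < 1]. *)
  apply: (@ereal_eq0_contraction _ _ (4 * C * a ^+ 2)) => //.
    by nra.
  have := @L2sqM_dense_ge _ _ _ mu E W mE (fun g Wg => (WL2 Wg).1) phi _ C mphi
    SL2.1 (L2_fin_num SL2) (denseW SL2) B C0 phiB phiW.
  rewrite L2sq_indic// setIidl// => h; apply: le_trans h _.
  rewrite (EFinM (4 * C)) -muleA lee_wpmul2l// ?lee_fin ?mulr_ge0//.
  have <- : L2sq mu E (fun t => (\1_S t : R)%:C%C) = mu S.
    by rewrite L2sq_indic// setIidl.
  apply: ae_L2sq_le; rewrite ?sqr_ge0//.
  - exact: cmeasurable_funM mphi SL2.1.
  - exact: SL2.1.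
  apply: aeW => t Et; rewrite normcM exprMn indicE.
  have [|] := boolP (t \in S); last by rewrite normc0 expr0n !mulr0.
  rewrite inE => -[_ /= ta].
  rewrite ler_wpM2r ?sqr_ge0// lerXn2r ?nnegrE ?normc_ge0//; exact: ltW.
apply: (@negligibleS _ _ _ _ S); last exact/(negligibleP _ mS).
by move=> t /= /not_implyP[Et /negP]; rewrite -ltNge.
Qed.

End essential_bounds.

(** * The equivalence over a set of finite measure *)

Theorem riesz_basis_mul_iff (d : measure_display) (T : measurableType d)
    (R : realType) (mu : {measure set T -> \bar R}) (E : set T) (K : countType)
    (phi : T -> R[i]) (psi : K -> T -> R[i]^o) :
  measurable E -> (mu E < +oo)%E -> cmeasurable_fun E phi ->
  riesz_basis (L2 mu E) (L2norm mu E) psi ->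
  riesz_basis (L2 mu E) (L2norm mu E) (fun k t => phi t * psi k t) <->
  exists A B : R, [/\ 0 < A, A <= B &
    {ae mu, forall t, E t -> A <= normc (phi t) <= B}].
Proof.
move=> mE Eoo mphi [psiL2 psicpl [a [b [a0 b0 psiab]]]].
have sumL2 (D : {fset K}) c : L2 mu E (\sum_(k <- D) c k *: psi k).
  exact: L2_sum.
split=> [[ppL2 _ [a' [b' [a'0 b'0 ppab]]]]|[A [B [A0 AB phiAB]]]].
- pose W := [set g : T -> R[i] | exists (D : {fset K}) c,
    g = \sum_(k <- D) c k *: psi k].
  have WL2 g : W g -> L2 mu E g by move=> [D [c ->]].
  have denseW f : L2 mu E f -> forall e : R, 0 < e ->
      exists2 g, W g & (L2sq mu E (fun t => f t - g t)%R <= e%:E)%E.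
    (* Completeness is stated for the seminorm and density of [W] for its square, hence the
       tolerance [Num.sqrt e]. *)
    move=> fL2 e e0; have se0 : 0 < Num.sqrt e by rewrite sqrtr_gt0.
    have [D [c fDc]] := psicpl _ fL2 _ se0.
    exists (\sum_(k <- D) c k *: psi k); first by exists D, c.
    have fgL2 : L2 mu E (f - \sum_(k <- D) c k *: psi k).
      by rewrite -scaleN1r; apply: L2D => //; exact: L2Z.
    rewrite -[leLHS]/(L2sq mu E (f - \sum_(k <- D) c k *: psi k)).
    rewrite -sqr_L2norm// lee_fin -[leRHS]sqr_sqrtr ?(ltW e0)//.
    by rewrite lerXn2r ?nnegrE ?sqrtr_ge0// ltW.
  have ppE (D : {fset K}) c :
      L2 mu E (fun t => phi t * (\sum_(k <- D) c k *: psi k) t).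
    by rewrite -sum_mul_fct; exact: L2_sum.
  (* The sum of the [|c_k|^2] links the two bases: the upper bound of one is combined with the lower
     bound of the other, here and in [Wge]. *)
  have Wle g : W g -> (L2sq mu E (fun t => phi t * g t)%R <=
      (b' / a)%:E * L2sq mu E g)%E.
    move=> [D [c ->]]; rewrite -!sqr_L2norm// -EFinM lee_fin -sum_mul_fct.
    have /andP[_ h1] := ppab D c; have /andP[h2 _] := psiab D c.
    apply: (le_trans h1); rewrite -mulrA ler_wpM2l// ?(ltW b'0)//.
    by rewrite mulrC ler_pdivlMr// mulrC.
  have Wge g : W g -> (L2sq mu E g <=
      (b / a')%:E * L2sq mu E (fun t => phi t * g t)%R)%E.
    move=> [D [c ->]]; rewrite -!sqr_L2norm// -EFinM lee_fin -sum_mul_fct.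
    have /andP[h1 _] := ppab D c; have /andP[_ h2] := psiab D c.
    apply: (le_trans h2); rewrite -mulrA ler_wpM2l// ?(ltW b0)//.
    by rewrite mulrC ler_pdivlMr// mulrC.
  have C0 : 0 <= b' / a by rewrite divr_ge0// ltW.
  have C'0 : 0 <= b / a' by rewrite divr_ge0// ltW.
  have phi_le := multiplier_ae_le mE Eoo mphi WL2 denseW C0 Wle.
  have phi_ge := multiplier_ae_ge mE Eoo mphi WL2 denseW C'0 phi_le Wge.
  exists (4 * (b / a') + 1)^-1, (4 * (b' / a) + 1); split.
  + by rewrite invr_gt0; lra.
  + apply: (@le_trans _ _ 1); last by lra.
    by rewrite invf_le1//; lra.
  + by apply: filterS2 phi_le phi_ge => t h1 h2 Et; rewrite h1// h2.
- have B0 : 0 < B by exact: lt_le_trans AB.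
  have phiB : {ae mu, forall t, E t -> normc (phi t) <= B}.
    by apply: filterS phiAB => t h /h /andP[].
  have phiA : {ae mu, forall t, E t -> A <= normc (phi t)}.
    by apply: filterS phiAB => t h /h /andP[].
  have ppL2 f : L2 mu E f -> L2 mu E (fun t => phi t * f t).
    by move=> fL2; exact: (L2_mul mE fL2 mphi phiB).
  split; first by move=> k; exact: ppL2.
  + move=> f fL2 e e0.
    (* Since [|phi| >= A] a.e., [g] lies in L^2(E) and [phi * g = f] a.e.; the value of the inverse
       at 0 matters only on a null set. *)
    pose g t := (phi t)^-1 * f t.
    have gL2 : L2 mu E g.
      apply: (L2_mul (B := A^-1) mE fL2); first exact: cmeasurable_funV.
      apply: filterS phiA => t h Et; rewrite normcV lef_pV2 ?posrE ?h//.
      exact: lt_le_trans A0 (h Et).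
    (* Multiplication by [phi] enlarges the seminorm by a factor at most [B], hence the tolerance
       [e / B]. *)
    have [D [c gDc]] := psicpl _ gL2 _ (divr_gt0 e0 B0).
    exists D, c; rewrite sum_mul_fct.
    set s := \sum_(k <- D) c k *: psi k in gDc *.
    have sL2 : L2 mu E s by exact: sumL2.
    have gsL2 : L2 mu E (g - s).
      by rewrite -scaleN1r; apply: L2D => //; exact: L2Z.
    have fsL2 : L2 mu E (f - (fun t => phi t * s t)).
      by rewrite -scaleN1r; apply: L2D => //; apply: L2Z => //; exact: ppL2.
    have : L2norm mu E (f - (fun t => phi t * s t)) ^+ 2 <=
        B ^+ 2 * L2norm mu E (g - s) ^+ 2.
      rewrite -lee_fin (EFinM (B ^+ 2)) !sqr_L2norm//; apply: ae_L2sq_le => //.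
      * exact: sqr_ge0.
      * exact: fsL2.1.
      * exact: gsL2.1.
      apply: filterS phiAB => t h Et; have /andP[hA hB] := h Et.
      have phi0 : phi t != 0.
        apply/eqP => phi0; move: hA; rewrite phi0 normc0.
        by rewrite leNgt A0.
      have -> : (f - (fun t => phi t * s t)) t = phi t * (g - s) t.
        by rewrite !fctE/= mulrBr mulrA divff// mul1r.
      rewrite normcM exprMn ler_wpM2r ?sqr_ge0//.
      by rewrite lerXn2r ?nnegrE ?normc_ge0// ltW.
    rewrite -exprMn ler_pXn2r ?nnegrE ?mulr_ge0 ?sqrtr_ge0 ?(ltW B0)// => h.
    by apply: le_lt_trans h _; rewrite mulrC -ltr_pdivlMr.
  (* Multiplication by [phi] scales squared norms by a factor between [A ^+ 2] and [B ^+ 2]. *)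
  + exists (A ^+ 2 * a), (B ^+ 2 * b).
    split; [exact: mulr_gt0 (exprn_gt0 _ A0) a0|
            exact: mulr_gt0 (exprn_gt0 _ B0) b0|move=> D c].
    rewrite sum_mul_fct; set s := \sum_(k <- D) c k *: psi k.
    have sL2 : L2 mu E s by exact: sumL2.
    have /andP[h1 h2] := psiab D c.
    have := ae_L2sqM_le mE sL2.1 mphi phiB.
    have := ae_L2sqM_ge mE A0 sL2.1 mphi phiA.
    rewrite -!sqr_L2norm//; last exact: ppL2.
    rewrite -!EFinM !lee_fin => hA hB; apply/andP; split.
      rewrite -mulrA -ler_pdivlMl ?exprn_gt0//.
      exact: le_trans h1 hA.
    apply: (le_trans hB); rewrite -mulrA ler_wpM2l// sqr_ge0//.
Qed.

(** * Finite measure of bounded sets and the case of R^d *)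

Lemma ler_coord_norm (R : realType) (d : nat) (x : 'rV[R]_d) (i : 'I_d) :
  `|x ord0 i| <= `|x|.
Proof.
rewrite [leRHS]/Num.Def.normr/= mx_normrE.
by apply: (le_trans _ (le_bigmax _ _ (ord0, i))).
Qed.

(** The norm is the maximum of the moduli of the coordinates, so a bounded set is covered by a
    single cube of finite volume. *)
Lemma lebesgue_outer_bounded (R : realType) (d : nat) (E : set 'rV[R]_d) :
  bounded_set E -> (lebesgue_outer R d E < +oo)%E.
Proof.
(* Boundedness provides a bound by every real strictly greater than [M], hence [M + 1]. *)
move=> [M [_ EM]]; have {}EM x : E x -> `|x| <= M + 1.
  by apply: EM; rewrite ltrDl.
pose p : 'rV[R]_d * 'rV[R]_d := (const_mx (- (M + 1)), const_mx (M + 1)).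
apply: (@le_lt_trans _ _ (\esum_(q in [set p]) (box_volume q)%:E)%E).
  apply: ereal_inf_lbound; exists [set p] => //; split=> [|x Ex].
    exact: finite_set_countable.
  exists p => // i; rewrite !mxE -ler_norml.
  exact: le_trans (ler_coord_norm x i) (EM x Ex).
by rewrite esum_set1 ?ltry// box_volume_ge0.
Qed.

Theorem proposition3p4 (R : realType) (d : nat)
    (E : set 'rV[R]_d) (bE : bounded_set E)
    (mE : measurable (E : set (Rn R d)))
    (K : countType)
    (phi : Rn R d -> R[i]) (mphi : cmeasurable_fun setT phi)
    (psi : K -> Rn R d -> R[i]^o)
    (rpsi : riesz_basis (L2 (lebesgue_rV R d) E) (L2norm (lebesgue_rV R d) E) psi) :
  riesz_basis (L2 (lebesgue_rV R d) E) (L2norm (lebesgue_rV R d) E)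
    (fun k t => phi t * psi k t)
  <->
  exists A B : R, [/\ 0 < A, A <= B &
    {ae lebesgue_rV R d, forall t, E t -> A <= normc (phi t) <= B}].
Proof.
have mphiE : cmeasurable_fun (E : set (Rn R d)) phi.
  by apply: cmeasurable_funS mphi; [exact: measurableT|exact: subsetT].
(* The measure [lebesgue_rV R d] is the outer measure itself on its measurable sets, so the outer
   bound gives finite measure directly. *)
by apply: riesz_basis_mul_iff mphiE rpsi; [exact: mE|exact: lebesgue_outer_bounded].
Qed.
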